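(* Let $d\ge 1$ and $1\le p,r\le\infty$, and let $r'$ denote the conjugate exponent of $r$ and $p'$ that of $p$. Suppose that there is a constant $C>0$ such that $$\|V_g f\|_{L^p(\mathbb{R}^{2d})}\le C\,\|g\|_{L^{r'}(\mathbb{R}^d)}\,\|f\|_{L^r(\mathbb{R}^d)}\qquad\text{for all } f,g\in\mathcal{S}(\mathbb{R}^d).$$ Then $p'\le\min\{r,r'\}$ (in particular, $p\ge 2$).
   Context: $\mathcal{S}(\mathbb{R}^d)$ is the Schwartz class. The short-time Fourier transform (STFT) of $f$ with window $g$ is $V_g f(x,\omega)=\int_{\mathbb{R}^d} f(t)\,\overline{g(t-x)}\,e^{-2\pi i\omega t}\,dt$ for $(x,\omega)\in\mathbb{R}^{2d}$, where $\omega t$ is the scalar product. *)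

(* Defs.v *)
From HB Require Import structures.
From mathcomp Require Import all_boot all_order all_algebra.
From mathcomp Require Import all_classical all_reals all_analysis.
From mathcomp Require Import complex.

Set Implicit Arguments.
Unset Strict Implicit.
Unset Printing Implicit Defensive.
Import Order.TTheory GRing.Theory Num.Theory.
Import numFieldNormedType.Exports.
Local Open Scope classical_set_scope.
Local Open Scope ring_scope.

(** * Lebesgue measure on R^n, with R^n represented by ['rV[R]_n] *)

Definition rV_display : measure_display.
Proof. exact: default_measure_display. Qed.

(* The sigma-algebra generated by the coordinates, i.e. the Borel sets. *)
Section measurable_rV.
Context (R : realType) (n : nat).

Definition rV_coord (i : 'I_n) (v : 'rV[R]_n) : measurableTypeR R := v ord0 i.

Let rV_set0 : g_sigma_preimage rV_coord set0.
Proof. exact: sigma_algebra0. Qed.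

Let rV_setC A : g_sigma_preimage rV_coord A -> g_sigma_preimage rV_coord (~` A).
Proof. exact: sigma_algebraC. Qed.

Let rV_bigcup (F : (set 'rV[R]_n)^nat) :
  (forall i, g_sigma_preimage rV_coord (F i)) ->
  g_sigma_preimage rV_coord (\bigcup_i (F i)).
Proof. exact: sigma_algebra_bigcup. Qed.

HB.instance Definition _ := @isMeasurable.Build rV_display
  'rV[R]_n (g_sigma_preimage rV_coord) rV_set0 rV_setC rV_bigcup.

End measurable_rV.

Section measurable_rV_theory.
Context (R : realType).
Implicit Types n : nat.

Lemma measurable_rV_coord n (i : 'I_n) :
  measurable_fun [set: 'rV[R]_n] (@rV_coord R n i).
Proof.
move=> _ Y mY; rewrite setTI; apply: sub_sigma_algebra => /=.
rewrite -bigcup_seq/=; exists i => /=; first by rewrite mem_index_enum.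
by exists Y => //; rewrite setTI.
Qed.

Lemma measurable_fun_rV n d (T : measurableType d) (f : T -> 'rV[R]_n) :
  (forall i, measurable_fun [set: T] (@rV_coord R n i \o f)) ->
  measurable_fun [set: T] f.
Proof.
move=> mf _ A mA.
have prefS : g_sigma_preimage (fun i => @rV_coord R n i \o f) `<=` measurable.
  apply: smallest_sub; first exact: sigma_algebra_measurable.
  case: n => [|n] in f A mA mf *; first by rewrite big_ord0.
  rewrite -bigcup_mkord_ord; apply: bigcup_sub => i Ii.
  by move=> B [C mC <-]; exact: mf.
by apply: prefS; rewrite g_sigma_preimage_comp; exists A.
Qed.

Definition rV_cons n (xv : measurableTypeR R * 'rV[R]_n) : 'rV[R]_n.+1 :=
  row_mx (xv.1 : R)%:M xv.2.

Definition rV_uncons n (v : 'rV[R]_n.+1) : measurableTypeR R * 'rV[R]_n :=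
  (v ord0 ord0, \row_j v ord0 (lift ord0 j)).

Lemma rV_cons0 n xv : @rV_cons n xv ord0 ord0 = xv.1.
Proof.
rewrite /rV_cons mxE; case: splitP => [k _|k //].
by rewrite mxE (ord1 k) eqxx mulr1n.
Qed.

Lemma rV_consS n xv j : @rV_cons n xv ord0 (lift ord0 j) = xv.2 ord0 j.
Proof.
rewrite /rV_cons mxE; case: splitP => [k|k [jk]]; first by rewrite (ord1 k).
by congr (xv.2 _ _); exact/val_inj.
Qed.

Lemma rV_consK n : cancel (@rV_cons n) (@rV_uncons n).
Proof.
move=> [x v]; congr pair; first by rewrite rV_cons0.
by apply/rowP => j; rewrite [LHS]mxE [LHS]rV_consS.
Qed.

Lemma rV_unconsK n : cancel (@rV_uncons n) (@rV_cons n).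
Proof.
move=> v; apply/rowP => j; have [<-|/unlift_some[k -> _]] := eqVneq ord0 j.
  by rewrite rV_cons0.
by rewrite rV_consS mxE.
Qed.

Lemma measurable_rV_cons n : measurable_fun [set: _] (@rV_cons n).
Proof.
apply: measurable_fun_rV => i.
have [<-|/unlift_some[k -> _]] := eqVneq ord0 i.
  rewrite [X in measurable_fun _ X](_ : _ = fst)//.
  by apply/funext => xv; rewrite /= /rV_coord rV_cons0.
rewrite [X in measurable_fun _ X](_ : _ = @rV_coord R n k \o snd).
  by apply: measurableT_comp => //; exact: measurable_rV_coord.
by apply/funext => xv; rewrite /= /rV_coord rV_consS.
Qed.

Lemma measurable_rV_uncons n : measurable_fun [set: _] (@rV_uncons n).
Proof.
apply/measurable_fun_pair; first exact: measurable_rV_coord.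
apply: measurable_fun_rV => i.
rewrite [X in measurable_fun _ X](_ : _ = @rV_coord R n.+1 (lift ord0 i)).
  exact: measurable_rV_coord.
by apply/funext => v; rewrite /= /rV_coord mxE.
Qed.

HB.instance Definition _ n := isMeasurableFun.Build _ _ _ _
  (@rV_cons n) (@measurable_rV_cons n).

End measurable_rV_theory.

Section lebesgue_rVS.
Context (R : realType) (n : nat).
Variable mu : {sigma_finite_measure set 'rV[R]_n -> \bar R}.

Definition lebesgue_rVS : set 'rV[R]_n.+1 -> \bar R :=
  pushforward (@lebesgue_measure R \x mu)%E (@rV_cons R n).

Let lebesgue_rVS0 : lebesgue_rVS set0 = 0%E.
Proof. exact: measure0. Qed.

Let lebesgue_rVS_ge0 A : (0 <= lebesgue_rVS A)%E.
Proof. exact: measure_ge0. Qed.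

Let lebesgue_rVS_sigma_additive : semi_sigma_additive lebesgue_rVS.
Proof. exact: measure_semi_sigma_additive. Qed.

HB.instance Definition _ := isMeasure.Build _ _ _ lebesgue_rVS
  lebesgue_rVS0 lebesgue_rVS_ge0 lebesgue_rVS_sigma_additive.

Let lebesgue_rVS_sigma_finite : sigma_finite [set: _] lebesgue_rVS.
Proof.
have /sigma_finiteP[F [FT ndF Foo]] := sigma_finiteT (@lebesgue_measure R).
have /sigma_finiteP[G [GT ndG Goo]] := sigma_finiteT mu.
have mcons A : measurable A -> measurable (@rV_uncons R n @^-1` A).
  by rewrite -[X in _ -> measurable X]setTI; exact: measurable_rV_uncons.
exists (fun k => @rV_uncons R n @^-1` (F k `*` G k)).
  apply/esym; rewrite -subTset => v _.
  have [i _ Fi] : (\bigcup_i F i) (v ord0 ord0) by rewrite -FT.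
  have [j _ Gj] : (\bigcup_j G j) (rV_uncons v).2 by rewrite -GT.
  exists (maxn i j) => //; split.
  - by apply: (subsetPset _ _ (ndF _ _ (leq_maxl i j))).
  - by apply: (subsetPset _ _ (ndG _ _ (leq_maxr i j))).
move=> k; have [mF Fk] := Foo k; have [mG Gk] := Goo k.
split; first by apply: mcons; exact: measurableX.
rewrite /lebesgue_rVS /pushforward -comp_preimage.
rewrite (_ : _ \o _ = id); last by apply/funext => v; exact: rV_consK.
by rewrite preimage_id product_measure1E// lte_mul_pinfty// ge0_fin_numE.
Qed.

HB.instance Definition _ := Measure_isSigmaFinite.Build _ _ _ lebesgue_rVS
  lebesgue_rVS_sigma_finite.

End lebesgue_rVS.

(* Iterated product of the one-dimensional Lebesgue measure, transported along
   R x R^n = R^(n+1); see [lebesgue_rV_box]. *)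
Fixpoint lebesgue_rV (R : realType) (n : nat) :
    {sigma_finite_measure set 'rV[R]_n -> \bar R} :=
  if n is n'.+1 then @lebesgue_rVS R n' (lebesgue_rV R n')
  else \d_(0 : 'rV[R]_0).

Lemma lebesgue_rV_box (R : realType) n (A : 'I_n -> set (measurableTypeR R)) :
  (forall i, measurable (A i)) ->
  lebesgue_rV R n [set v | forall i, A i (v ord0 i)] =
  (\big[mule/1]_(i < n) lebesgue_measure (A i))%E.
Proof.
elim: n A => [|n IHn] A mA.
  by rewrite big_ord0 /= diracE mem_set// => -[].
have mbox : measurable [set v : 'rV[R]_n | forall i, A (lift ord0 i) (v ord0 i)].
  rewrite (_ : [set _ | _] =
      \bigcap_(i in [set: 'I_n]) (@rV_coord R n i @^-1` A (lift ord0 i))).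
    apply: fin_bigcap_measurable => [|i _]; first exact: finite_finset.
    by rewrite -[X in measurable X]setTI; exact: measurable_rV_coord.
  by apply/seteqP; split => v /= Av i => [_|]; exact: Av.
rewrite big_ord_recl -IHn; last by move=> i; exact: mA.
rewrite -product_measure1E//= /lebesgue_rVS /pushforward.
congr (product_measure1 _ _ _).
apply/seteqP; split => -[x v] /=.
  move=> Axv; split; first by have := Axv ord0; rewrite rV_cons0.
  by move=> i; have := Axv (lift ord0 i); rewrite rV_consS.
move=> [/= Ax Av] i; have [<-|/unlift_some[k -> _]] := eqVneq ord0 i.
  by rewrite rV_cons0.
by rewrite rV_consS; exact: Av.
Qed.

(** * Complex-valued functions *)

(* Derivatives, continuity and integrals of complex-valued functions are taken
   componentwise, on the real and imaginary parts. *)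

Definition expi (R : realType) (t : R) : R[i] := (cos t +i* sin t)%C.

Definition cintegral d (T : measurableType d) (R : realType)
    (mu : {measure set T -> \bar R}) (h : T -> R[i]) : R[i] :=
  (\int[mu]_t complex.Re (h t) +i* \int[mu]_t complex.Im (h t))%C.

Definition cLnorm d (T : measurableType d) (R : realType)
    (mu : {measure set T -> \bar R}) (p : \bar R) (h : T -> R[i]) : \bar R :=
  Lnorm mu p (fun t => (Normc.normc (h t))%:E).

(** * The Schwartz class *)

Section schwartz.
Context (R : realType) (d : nat).
Implicit Types (f : 'rV[R]_d -> R[i]) (x : 'rV[R]_d).

Definition cderivable f x (j : 'I_d) : Prop :=
  derivable (fun y => complex.Re (f y)) x (delta_mx ord0 j) /\
  derivable (fun y => complex.Im (f y)) x (delta_mx ord0 j).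

Definition partial (j : 'I_d) f : 'rV[R]_d -> R[i] := fun x =>
  ('D_(delta_mx ord0 j) (fun y => complex.Re (f y)) x +i*
   'D_(delta_mx ord0 j) (fun y => complex.Im (f y)) x)%C.

Definition ccontinuous f : Prop :=
  continuous (fun y => complex.Re (f y)) /\
  continuous (fun y => complex.Im (f y)).

Definition partials (s : seq 'I_d) f : 'rV[R]_d -> R[i] := foldr partial f s.

Definition smooth f : Prop := forall s : seq 'I_d,
  ccontinuous (partials s f) /\ forall x j, cderivable (partials s f) x j.

(* The derivative of multi-index [beta]; the order in which the partial
   derivatives are taken is immaterial for smooth functions. *)
Definition partial_multi (beta : 'I_d -> nat) f : 'rV[R]_d -> R[i] :=
  partials (flatten [seq nseq (beta j) j | j <- enum 'I_d]) f.

Definition monomial (alpha : 'I_d -> nat) x : R :=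
  \prod_(j < d) x ord0 j ^+ alpha j.

Definition schwartz f : Prop :=
  smooth f /\
  forall alpha beta : 'I_d -> nat, exists M : R, forall x,
    `|monomial alpha x| * Normc.normc (partial_multi beta f x) <= M.

End schwartz.

(** * The short-time Fourier transform *)

Definition dotv (R : realType) d (x y : 'rV[R]_d) : R :=
  \sum_(j < d) x ord0 j * y ord0 j.

Definition stft (R : realType) d (g f : 'rV[R]_d -> R[i])
    (xw : 'rV[R]_d * 'rV[R]_d) : R[i] :=
  cintegral (lebesgue_rV R d) (fun t =>
    f t * (g (t - xw.1))^*%C * expi (- (2 * pi * dotv xw.2 t))).

(* Main.v *)
From HB Require Import structures.
Require Import Defs.
From mathcomp Require Import all_boot all_order all_algebra.
From mathcomp Require Import all_classical all_reals all_analysis.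
From mathcomp Require Import measurable_realfun ess_sup_inf complex.
From mathcomp Require Import ring lra.
Import Order.TTheory GRing.Theory Num.Theory.
Import numFieldNormedType.Exports.

Set Implicit Arguments.
Unset Strict Implicit.
Unset Printing Implicit Defensive.
Local Open Scope classical_set_scope.
Local Open Scope ring_scope.

(* Test the inequality on the Gaussians G_a(t) = exp(-a|t|^2), with one of f, g
   equal to G_1 and the other to G_(s-1), s -> oo. Completing the square,
   |V(x, w)| is at least c s^(-d/2) on the cube 0 <= x_j <= 1,
   0 <= w_j <= k sqrt s, so the p-norm of V is at least c' s^(-d/2 + d/(2p)),
   while the right-hand side is O(s^(-d/(2q))), with q = r if f is the narrow
   Gaussian and q = r' if g is. Hence 1/q <= 1 - 1/p for both values of q. If
   p = oo or q = oo there is nothing to prove. *)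

(** * Gaussians are Schwartz functions *)

Section gaussian_schwartz.
Context (R : realType) (d : nat).
Implicit Types (a : R) (x y : 'rV[R]_d) (p q : 'rV[R]_d -> R).

Definition gaussian a x : R := expR (- (a * dotv x x)).

(** Polynomial functions, given by their construction, so that differentiability, stability under
    partial derivatives and growth bounds all follow by induction. *)
Inductive polyfun : ('rV[R]_d -> R) -> Prop :=
| polyfun_cst c : polyfun (fun=> c)
| polyfun_coord j : polyfun (fun x => x ord0 j)
| polyfunD p q : polyfun p -> polyfun q -> polyfun (fun x => p x + q x)
| polyfunM p q : polyfun p -> polyfun q -> polyfun (fun x => p x * q x).

Lemma derive_coord x (v : 'rV[R]_d) j : 'D_v (fun y => y ord0 j) x = v ord0 j.
Proof.
rewrite deriveE; last exact: differentiable_coord.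
have lin_coord : linear (fun y : 'rV[R]_d => y ord0 j : R).
  by move=> k y z; rewrite !mxE.
(* Packed as a continuous linear map, the coordinate is its own differential. *)
pose coordM := GRing.isLinear.Build _ _ _ _ _ lin_coord.
pose coordL : {linear 'rV[R]_d -> R} := HB.pack (fun y : 'rV[R]_d => y ord0 j) coordM.
by rewrite (_ : (fun y => _) = coordL)// diff_lin//; exact: coord_continuous.
Qed.

Lemma dotv_ge0 x : 0 <= dotv x x.
Proof. by apply: sumr_ge0 => j _; rewrite -expr2 sqr_ge0. Qed.

Lemma polyfun_dotv : polyfun (fun x => dotv x x).
Proof.
rewrite /dotv; elim: (index_enum _) => [|j s ih].
  by under eq_fun do rewrite big_nil; exact: polyfun_cst.
under eq_fun do rewrite big_cons.
by apply: polyfunD => //; apply: polyfunM; exact: polyfun_coord.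
Qed.

Lemma polyfunX p n : polyfun p -> polyfun (fun x => p x ^+ n).
Proof.
move=> Pp; elim: n => [|n ih].
  by under eq_fun do rewrite expr0; exact: polyfun_cst.
by under eq_fun do rewrite exprS; exact: polyfunM.
Qed.

Lemma polyfun_monomial (alpha : 'I_d -> nat) : polyfun (monomial alpha).
Proof.
rewrite /monomial; elim: (index_enum _) => [|j s ih].
  by under eq_fun do rewrite big_nil; exact: polyfun_cst.
under eq_fun do rewrite big_cons.
by apply: polyfunM => //; apply: polyfunX; exact: polyfun_coord.
Qed.

Lemma polyfun_differentiable p x : polyfun p -> differentiable p x.
Proof.
elim=> [c|j|{}p q _ dp _ dq|{}p q _ dp _ dq].
- exact: differentiable_cst.
- exact: differentiable_coord.
- exact: differentiableD.
- exact: differentiableM.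
Qed.

Lemma polyfun_derive p (j : 'I_d) :
  polyfun p -> polyfun (fun x => 'D_(delta_mx ord0 j) p x).
Proof.
elim=> [c|k|{}p q Pp dp Pq dq|{}p q Pp dp Pq dq].
- under eq_fun do rewrite derive_cst.
  exact: polyfun_cst.
- under eq_fun do rewrite derive_coord.
  exact: polyfun_cst.
- under eq_fun => x.
    rewrite deriveD; [over| |];
      by apply: diff_derivable; exact: polyfun_differentiable.
  exact: polyfunD.
- under eq_fun => x.
    rewrite deriveM; [over| |];
      by apply: diff_derivable; exact: polyfun_differentiable.
  by apply: polyfunD; exact: polyfunM.
Qed.

(** Induction on the construction of [p], with [e] kept general because a product has to share its
    exponent between two factors. *)
Lemma polyfun_growth p (e : R) : 0 < e -> polyfun p ->
  exists M, forall x, `|p x| <= M * expR (e * dotv x x).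
Proof.
move=> + Pp; elim: Pp e => [c|j|{}p q _ ihp _ ihq|{}p q _ ihp _ ihq] e e0.
- exists `|c| => x; rewrite ler_peMr// -expR0 ler_expR.
  by rewrite mulr_ge0 ?dotv_ge0// ltW.
(* The constant comes from |u| <= 1 + u^2 <= (1 + 1/e)(1 + e|x|^2), followed by 1 + y <= exp y. *)
- exists (1 + e^-1) => x; set u := x ord0 j.
  have u2 : u ^+ 2 <= dotv x x.
    rewrite /dotv (bigD1 j)//= -expr2 lerDl.
    by apply: sumr_ge0 => i _; rewrite -expr2 sqr_ge0.
  apply: (@le_trans _ _ ((1 + e^-1) * (1 + e * dotv x x))); last first.
    by rewrite ler_wpM2l ?expR_ge1Dx// addr_ge0// invr_ge0 ltW.
  rewrite mulrDr mulr1 mulrDl mul1r mulKf ?gt_eqF//.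
  have : `|u| <= 1 + u ^+ 2 by rewrite -real_normK ?num_real//; nra.
  have : 0 <= e * dotv x x by rewrite mulr_ge0 ?dotv_ge0// ltW.
  have : 0 < e^-1 by rewrite invr_gt0.
  lra.
- have [M HM] := ihp _ e0; have [N HN] := ihq _ e0; exists (M + N) => x.
  by rewrite mulrDl (le_trans (ler_normD _ _))// lerD.
(* Each factor is allowed half of the rate [e]. *)
- have e20 : 0 < e / 2 by rewrite divr_gt0.
  have [M HM] := ihp _ e20; have [N HN] := ihq _ e20; exists (M * N) => x.
  rewrite [e in expR (e * _)](splitr e) mulrDl expRD mulrACA normrM.
  exact: ler_pM.
Qed.

Lemma gaussian_ge0 a x : 0 <= gaussian a x.
Proof. exact: expR_ge0. Qed.

Lemma gaussian_differentiable a x : differentiable (gaussian a) x.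
Proof.
apply: (@differentiable_comp _ _ _ _ (fun x => - (a * dotv x x)) expR).
  apply: differentiableN; apply: differentiableM; first exact: differentiable_cst.
  exact: (polyfun_differentiable _ polyfun_dotv).
exact/derivable1_diffP/derivable_expR.
Qed.

Lemma gaussian_derive a x (v : 'rV[R]_d) :
  'D_v (gaussian a) x = - a * 'D_v (fun y => dotv y y) x * gaussian a x.
Proof.
pose q y := - (a * dotv y y).
have dq : differentiable q x.
  apply: differentiableN; apply: differentiableM; first exact: differentiable_cst.
  exact: (polyfun_differentiable _ polyfun_dotv).
have de : differentiable expR (q x) by exact/derivable1_diffP/derivable_expR.
rewrite (_ : gaussian a = expR \o q)// deriveE; last exact: differentiable_comp.
rewrite diff_comp// /= diff1E// derive1E -deriveE//
  (_ : 'D_1 expR (q x) = expR (q x)); last by apply: derive_val.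
rewrite deriveN; last first.
  apply: derivableM; first exact: derivable_cst.
  exact/diff_derivable/polyfun_differentiable/polyfun_dotv.
rewrite deriveM; [|exact: derivable_cst|
  exact/diff_derivable/polyfun_differentiable/polyfun_dotv].
by rewrite derive_cst scaler0 addr0 [LHS]mulrC [RHS]mulrC mulNr.
Qed.

(** The derivative of G_a is a polynomial times G_a, so by the product rule the functions of the
    form polynomial times G_a are stable under every partial derivative. *)
Lemma partials_gaussian a (s : seq 'I_d) : exists2 p, polyfun p &
  partials s (fun x => (gaussian a x)%:C%C) = (fun x => (p x * gaussian a x)%:C%C).
Proof.
elim: s => [|j s [p Pp IH]] /=.
  by exists (fun=> 1); [exact: polyfun_cst|under [RHS]eq_fun do rewrite mul1r].
exists (fun x => 'D_(delta_mx ord0 j) p x +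
    p x * (- a * 'D_(delta_mx ord0 j) (fun y => dotv y y) x)).
  apply: polyfunD; first exact: polyfun_derive.
  apply: polyfunM => //; apply: polyfunM; first exact: polyfun_cst.
  exact/polyfun_derive/polyfun_dotv.
rewrite IH /partial; apply/funext => x /=; congr (_ +i* _)%C; last exact: derive_cst.
rewrite deriveM.
- by rewrite gaussian_derive /GRing.scale/=; ring.
- exact/diff_derivable/polyfun_differentiable.
- exact/diff_derivable/gaussian_differentiable.
Qed.

Lemma schwartz_gaussian a : 0 < a -> schwartz (fun x => (gaussian a x)%:C%C).
Proof.
move=> a0; split=> [s|alpha beta].
  have [p Pp ->] := partials_gaussian a s.
  have dpG x : differentiable (fun y => p y * gaussian a y) x.
    by apply: differentiableM; [exact: polyfun_differentiable|
      exact: gaussian_differentiable].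
  split; last by move=> x j; split; [exact: diff_derivable|exact: derivable_cst].
  split=> x; last exact: cst_continuous.
  exact: (differentiable_continuous (dpG x)).
rewrite /partial_multi; set js := flatten _.
have [p Pp ->] := partials_gaussian a js.
(* Growth at rate exactly [a] is what the factor G_a cancels. *)
have [M HM] := polyfun_growth a0 (polyfunM (polyfun_monomial alpha) Pp).
exists M => x; rewrite /= expr0n addr0 sqrtr_sqr normrM (ger0_norm (gaussian_ge0 a x)).
rewrite mulrA -normrM -ler_pdivlMr ?expR_gt0// /gaussian -expRN opprK.
exact: HM.
Qed.

End gaussian_schwartz.

(** * Gaussian integrals over R^d *)

Section gaussian_integral.
Context (R : realType).

(** Induction on [d]: Tonelli splits off coordinate 0. In dimension 0 the measure is a unit mass and
    the product is empty, so both sides are 1. *)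
Lemma integral_rV_prod d (F : 'I_d -> R -> R) (I : 'I_d -> R) :
  (forall i, measurable_fun [set: R] (F i)) ->
  (forall i x, 0 <= F i x) ->
  (forall i, \int[lebesgue_measure]_x (F i x)%:E = (I i)%:E)%E ->
  (\int[lebesgue_rV R d]_t (\prod_i F i (t ord0 i))%:E = (\prod_i I i)%:E)%E.
Proof.
have mprod n (G : 'I_n -> R -> R) : (forall i, measurable_fun [set: R] (G i)) ->
    measurable_fun [set: 'rV[R]_n] (fun t => (\prod_i G i (t ord0 i))%:E).
  move=> mG; apply/measurable_EFinP.
  apply: (@measurable_prod _ _ R setT 'I_n (index_enum _)
    (fun i (t : 'rV[R]_n) => G i (t ord0 i))) => i _.
  exact: (measurableT_comp (mG i) (measurable_rV_coord i)).
elim: d F I => [|d IH] F I mF F0 FI.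
  under eq_integral do rewrite big_ord0.
  by rewrite big_ord0 /= integral_cst//= diracT mule1.
rewrite /= ge0_integral_pushforward//=; last 2 first.
- exact: mprod.
- by move=> t _; rewrite lee_fin prodr_ge0.
rewrite preimage_setT fubini_tonelli1/=; last 2 first.
- exact: (measurableT_comp (mprod _ _ mF) (@measurable_rV_cons R d)).
- by move=> t; rewrite lee_fin prodr_ge0.
transitivity (\int[lebesgue_measure]_x
    ((F ord0 x)%:E * (\prod_(i < d) I (lift ord0 i))%:E))%E.
  apply: eq_integral => x _; rewrite /fubini_F/=.
  rewrite -(IH (fun i => F (lift ord0 i)))//.
  rewrite -ge0_integralZl//=; last 3 first.
  - exact: (mprod _ (fun i => F (lift ord0 i))).
  - by move=> v _; rewrite lee_fin prodr_ge0.
  - by rewrite lee_fin.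
  apply: eq_integral => v _; rewrite big_ord_recl rV_cons0.
  by rewrite EFinM; congr (_ * (_)%:E)%E; apply: eq_bigr => i _; rewrite rV_consS.
rewrite ge0_integralZr//=.
- by rewrite FI -EFinM big_ord_recl.
- apply/measurable_EFinP; exact: mF.
- by move=> x _; rewrite lee_fin.
- rewrite lee_fin prodr_ge0// => i _; rewrite -lee_fin -FI.
  by apply: integral_ge0 => x _; rewrite lee_fin.
Qed.

(** The integrand is a multiple of the normal density of mean [m] and variance 1/(2a), whose total
    mass is 1. *)
Lemma integral_gauss1 (a m : R) : 0 < a ->
  (\int[lebesgue_measure]_x (expR (- (a * (x - m) ^+ 2)))%:E =
   (Num.sqrt (pi / a))%:E)%E.
Proof.
move=> a0; pose s := Num.sqrt ((2 * a)^-1).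
have s2 : s ^+ 2 = (2 * a)^-1 by rewrite sqr_sqrtr// invr_ge0 mulr_ge0// ltW.
have s0 : s != 0 by rewrite gt_eqF// sqrtr_gt0 invr_gt0 mulr_gt0.
have peakE : normal_peak s = (Num.sqrt (pi / a))^-1.
  by rewrite /normal_peak s2 -mulr_natl; congr (Num.sqrt _)^-1; field; rewrite gt_eqF.
have pa0 : 0 < Num.sqrt (pi / a) by rewrite sqrtr_gt0 divr_gt0// pi_gt0.
have -> : (fun x => (expR (- (a * (x - m) ^+ 2)))%:E) =
    (fun x => (Num.sqrt (pi / a))%:E * (normal_pdf m s x)%:E)%E.
  apply/funext => x; rewrite normal_pdfE//= peakE -EFinM mulVKf ?gt_eqF//.
  rewrite /normal_fun s2; congr (expR _)%:E; rewrite -mulr_natl; field.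
  by rewrite gt_eqF.
rewrite ge0_integralZl//=.
- by rewrite integral_normal_pdf mule1.
- by apply/measurable_EFinP; exact: measurable_normal_pdf.
- by move=> x _; rewrite lee_fin normal_pdf_ge0.
Qed.

Lemma gaussianE d (a : R) (x : 'rV[R]_d) :
  gaussian a x = \prod_i expR (- (a * x ord0 i ^+ 2)).
Proof. by rewrite -expR_sum sumrN -mulr_sumr. Qed.

Lemma measurable_gaussian d (a : R) (c : 'rV[R]_d) :
  measurable_fun [set: 'rV[R]_d] (fun t => gaussian a (t - c)).
Proof.
apply: (measurableT_comp (@measurable_expR R)).
apply/measurableT_comp => //; apply: measurable_funM => //.
apply: measurable_sum => j.
under eq_fun do rewrite !mxE.
by apply: measurable_funM; apply: measurable_funB => //; exact: measurable_rV_coord.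
Qed.

Lemma integral_gaussian d (a : R) (c : 'rV[R]_d) : 0 < a ->
  (\int[lebesgue_rV R d]_t (gaussian a (t - c))%:E =
   (Num.sqrt (pi / a) ^+ d)%:E)%E.
Proof.
move=> a0; under eq_integral do rewrite gaussianE.
under eq_integral do under eq_bigr do rewrite !mxE.
rewrite (@integral_rV_prod _ (fun i y => expR (- (a * (y - c ord0 i) ^+ 2)))
  (fun=> Num.sqrt (pi / a))).
- by rewrite prodr_const card_ord.
- move=> i; apply: measurableT_comp => //; apply: measurableT_comp => //.
  by apply: measurable_funM => //; apply: measurable_funX; exact: measurable_funB.
- by move=> i x; exact: expR_ge0.
- by move=> i; exact: integral_gauss1.
Qed.

End gaussian_integral.

(** * Pointwise lower bound for the STFT of two Gaussians *)

Section stft_lower_bound.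
Context (R : realType).

(** Both sides are even; for x >= 0 the mean value theorem gives sin x = x cos z. *)
Lemma sin_sqr_le (x : R) : sin x ^+ 2 <= x ^+ 2.
Proof.
wlog x0 : x / 0 <= x.
  move=> H; have [/H//|/ltW x0] := leP 0 x.
  by rewrite -sqrrN -sinN -[x ^+ 2]sqrrN H// oppr_ge0.
have [|z _] := @MVT_segment R sin cos 0 x x0.
  by apply: continuous_subspaceT => z; exact: continuous_sin.
rewrite sin0 !subr0 => ->; rewrite exprMn ler_piMl ?sqr_ge0//.
Qed.

(** Half-angle formula: cos x = 1 - 2 sin^2(x/2). *)
Lemma cos_ge (x : R) : 1 - x ^+ 2 / 2 <= cos x.
Proof.
rewrite [in leRHS](_ : x = (x / 2) *+ 2); last by rewrite -mulr_natr divfK.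
rewrite cos_mulr2n cos2sin2.
have := sin_sqr_le (x / 2); rewrite exprMn -mulr_natr; lra.
Qed.

(** The left-hand side is the real part of exp(iu) z, and |z|^2 exceeds its square by the square of
    the imaginary part. *)
Lemma normc_ge_rotation (z : R[i]) (u : R) :
  cos u * complex.Re z - sin u * complex.Im z <= Normc.normc z.
Proof.
case: z => x y /=; apply: (le_trans (ler_norm _)); rewrite -sqrtr_sqr ler_wsqrtr//.
have := cos2Dsin2 u; have := sqr_ge0 (cos u * y + sin u * x); nra.
Qed.

Section dotv_theory.
Context (d : nat).
Implicit Types (x y z : 'rV[R]_d) (k : R).

Lemma dotvC x y : dotv x y = dotv y x.
Proof. by apply: eq_bigr => j _; rewrite mulrC. Qed.

Lemma dotvDr x y z : dotv x (y + z) = dotv x y + dotv x z.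
Proof. by rewrite -big_split; apply: eq_bigr => j _; rewrite mxE mulrDr. Qed.

Lemma dotvZr k x y : dotv x (k *: y) = k * dotv x y.
Proof. by rewrite mulr_sumr; apply: eq_bigr => j _; rewrite mxE mulrCA. Qed.

Lemma dotvBr x y z : dotv x (y - z) = dotv x y - dotv x z.
Proof. by rewrite dotvDr -scaleN1r dotvZr mulN1r. Qed.

Lemma dotvv_sqrD x y : dotv (x + y) (x + y) = dotv x x + 2 * dotv x y + dotv y y.
Proof. by rewrite dotvDr !(dotvC (x + y)) !dotvDr (dotvC y x); ring. Qed.

Lemma dotvv_sqrB x y : dotv (x - y) (x - y) = dotv x x - 2 * dotv x y + dotv y y.
Proof. by rewrite dotvBr !(dotvC (x - y)) !dotvBr (dotvC y x); ring. Qed.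

Lemma dotv_cauchy_schwarz x y : dotv x y ^+ 2 <= dotv x x * dotv y y.
Proof.
have q k : 0 <= dotv x x + 2 * (k * dotv x y) + k ^+ 2 * dotv y y.
  have := dotv_ge0 (x + k *: y).
  by rewrite dotvv_sqrD !dotvZr (dotvC (k *: y)) dotvZr expr2 -mulrA.
have [y0|yn0] := eqVneq (dotv y y) 0.
  have y_eq0 j : y ord0 j = 0.
    have : (\sum_j y ord0 j * y ord0 j == 0) by rewrite -[X in X == _]/(dotv y y) y0.
    rewrite psumr_eq0; last by move=> i _; rewrite -expr2 sqr_ge0.
    by move=> /allP/(_ j)/(_ (mem_index_enum _)); rewrite /= mulf_eq0 orbb => /eqP.
  by rewrite y0 mulr0 /dotv big1 ?expr0n// => j _; rewrite y_eq0 mulr0.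
have yy : 0 < dotv y y by rewrite lt_neqAle eq_sym yn0 dotv_ge0.
(* The quadratic k -> |x + k y|^2 is evaluated at its minimum. *)
have := q (- (dotv x y / dotv y y)).
have -> : dotv x x + 2 * (- (dotv x y / dotv y y) * dotv x y) +
   (- (dotv x y / dotv y y)) ^+ 2 * dotv y y = dotv x x - dotv x y ^+ 2 / dotv y y.
  by field.
by rewrite subr_ge0 ler_pdivrMr.
Qed.

End dotv_theory.

Context (d : nat).
Implicit Types (a b s : R) (x c w t : 'rV[R]_d).

(** Completing the square in [t]: the new center is the mean of 0 and [x] with weights [a] and
    [b]. *)
Lemma gaussianM_shift a b x t : 0 < a -> 0 < b ->
  gaussian a t * gaussian b (t - x) =
  expR (- (a * b / (a + b) * dotv x x)) * gaussian (a + b) (t - (b / (a + b)) *: x).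
Proof.
move=> a0 b0; rewrite -!expRD; congr expR.
rewrite !dotvv_sqrB !dotvZr (dotvC (_ *: x)) dotvZr.
by field; rewrite gt_eqF// addr_gt0.
Qed.

Lemma integrable_gaussian a c : 0 < a ->
  (lebesgue_rV R d).-integrable setT (fun t => (gaussian a (t - c))%:E).
Proof.
move=> a0; apply/integrableP; split.
  by apply/measurable_EFinP; exact: measurable_gaussian.
under eq_integral do rewrite gee0_abs ?lee_fin ?gaussian_ge0//.
by rewrite integral_gaussian// ltry.
Qed.

Lemma Rintegral_gaussian a c : 0 < a ->
  \int[lebesgue_rV R d]_t gaussian a (t - c) = Num.sqrt (pi / a) ^+ d.
Proof. by move=> a0; rewrite /Rintegral integral_gaussian. Qed.

(** Halving the parameter gains the factor exp(a|x|^2/2), which is at least a|x|^2/2. This is how a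
    quadratic factor is absorbed into a wider Gaussian. *)
Lemma dotv_gaussian_le a x : 0 < a ->
  dotv x x * gaussian a x <= 2 / a * gaussian (a / 2) x.
Proof.
move=> a0; have -> : gaussian (a / 2) x = expR (a / 2 * dotv x x) * gaussian a x.
  by rewrite -expRD; congr expR; field.
rewrite mulrA ler_wpM2r ?gaussian_ge0// -ler_pdivrMl ?divr_gt0// invf_div.
by apply: le_trans (expR_ge1Dx _); rewrite lerDr.
Qed.

(* The product G_a(t) G_b(t - x) is a multiple of G_(a+b) centered at c. Rotating
   V(x, w) by the phase at c leaves the factor cos(2 pi w.(t - c)), which is at
   least 1 - 2 pi^2 |w|^2 |t - c|^2; the second term is absorbed into a wider
   Gaussian, of parameter (a + b) / 2. *)
Lemma stft_gaussian_ge a b x w : 0 < a -> 0 < b ->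
  expR (- (a * b / (a + b) * dotv x x)) *
    (Num.sqrt (pi / (a + b)) ^+ d -
     4 * pi ^+ 2 * dotv w w / (a + b) * Num.sqrt (2 * pi / (a + b)) ^+ d) <=
  Normc.normc (stft (fun t => (gaussian b t)%:C%C) (fun t => (gaussian a t)%:C%C) (x, w)).
Proof.
move=> a0 b0; have s0 : 0 < a + b by rewrite addr_gt0.
set s := a + b in s0 *; pose c := (b / s) *: x.
set K := expR _; have K0 : 0 < K by exact: expR_gt0.
pose phi t := - (2 * pi * dotv w t); pose u := - phi c.
pose h t := K * gaussian s (t - c).
have ih : (lebesgue_rV R d).-integrable setT (EFin \o h).
  exact: (integrableZl measurableT K (integrable_gaussian c s0)).
have mphi : measurable_fun [set: 'rV[R]_d] phi.
  apply: measurableT_comp => //; apply: measurable_funM => //.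
  apply: measurable_sum => j; apply: measurable_funM => //.
  exact: measurable_rV_coord.
have ibnd (f : _ -> R) : measurable_fun [set: 'rV[R]_d] f -> (forall t, `|f t| <= 1) ->
    (lebesgue_rV R d).-integrable setT (EFin \o (fun t => h t * f t)).
  move=> mf f1; apply: le_integrable ih => //.
    apply/measurable_EFinP; apply: measurable_funM => //.
    by apply: measurable_funM => //; exact: measurable_gaussian.
  by move=> t _ /=; rewrite lee_fin normrM ler_piMr.
have mcos := continuous_measurable_fun (@continuous_cos R).
have msin := continuous_measurable_fun (@continuous_sin R).
have icos v : (lebesgue_rV R d).-integrable setT
    (EFin \o (fun t => h t * cos (phi t + v))).
  apply: ibnd => [|t]; last exact: cos_max.
  by apply: measurableT_comp; [exact: mcos|exact: measurable_funD].
have isin : (lebesgue_rV R d).-integrable setT (EFin \o (fun t => h t * sin (phi t))).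
  by apply: ibnd => [|t]; [exact: (measurableT_comp msin mphi)|exact: sin_max].
have icos0 : (lebesgue_rV R d).-integrable setT (EFin \o (fun t => h t * cos (phi t))).
  by apply: ibnd => [|t]; [exact: (measurableT_comp mcos mphi)|exact: cos_max].
apply: le_trans (normc_ge_rotation _ u).
have hE t : gaussian a t * gaussian b (t - x) = h t by exact: gaussianM_shift.
have -> : complex.Re (stft (fun t => (gaussian b t)%:C%C)
    (fun t => (gaussian a t)%:C%C) (x, w)) = \int[lebesgue_rV R d]_t (h t * cos (phi t)).
  by apply: eq_Rintegral => t _ /=; rewrite -hE; ring.
have -> : complex.Im (stft (fun t => (gaussian b t)%:C%C)
    (fun t => (gaussian a t)%:C%C) (x, w)) = \int[lebesgue_rV R d]_t (h t * sin (phi t)).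
  by apply: eq_Rintegral => t _ /=; rewrite -hE; ring.
rewrite -!RintegralZl// -RintegralB//; last 2 first.
- exact: (integrableZl measurableT (cos u) icos0).
- exact: (integrableZl measurableT (sin u) isin).
rewrite (_ : (fun t => _) = fun t => h t * cos (phi t + u)); last first.
  by apply/funext => t; rewrite cosD; ring.
set q := 4 * pi ^+ 2 * dotv w w / s.
have s20 : 0 < s / 2 by rewrite divr_gt0.
have i1 : (lebesgue_rV R d).-integrable setT
    (EFin \o (fun t => K * gaussian s (t - c))) by [].
have i2 : (lebesgue_rV R d).-integrable setT
    (EFin \o (fun t => K * q * gaussian (s / 2) (t - c))).
  exact: (integrableZl measurableT (K * q) (integrable_gaussian c s20)).
(* Both terms of the bound are Gaussian integrals, so it is enough to compare integrands
   pointwise. *)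
have -> : K * (Num.sqrt (pi / s) ^+ d - q * Num.sqrt (2 * pi / s) ^+ d) =
    \int[lebesgue_rV R d]_t (K * gaussian s (t - c) - K * q * gaussian (s / 2) (t - c)).
  rewrite RintegralB// !RintegralZl//; [|exact: integrable_gaussian..].
  rewrite !Rintegral_gaussian// mulrBr mulrA; congr (_ - _ * Num.sqrt _ ^+ _).
  by field; rewrite gt_eqF.
apply: le_Rintegral => //.
  exact: (integrableB measurableT i1 i2).
move=> t _; have -> : phi t + u = - (2 * pi * dotv w (t - c)).
  by rewrite /u /phi dotvBr; ring.
rewrite cosN -mulrA -mulrBr /h -mulrA ler_pM2l//.
apply: le_trans (ler_wpM2l (gaussian_ge0 _ _) (cos_ge _)).
rewrite mulrBr mulr1 lerD2l lerN2.
have -> : q * gaussian (s / 2) (t - c) =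
    2 * pi ^+ 2 * (dotv w w * (2 / s * gaussian (s / 2) (t - c))).
  by rewrite /q; field; rewrite gt_eqF.
apply: (@le_trans _ _ (2 * pi ^+ 2 *
    (dotv w w * (dotv (t - c) (t - c) * gaussian s (t - c))))); last first.
  apply: ler_wpM2l; first by rewrite mulr_ge0// sqr_ge0.
  by apply: ler_wpM2l; [exact: dotv_ge0|exact: dotv_gaussian_le].
apply: (@le_trans _ _ (2 * pi ^+ 2 * (dotv w (t - c) ^+ 2 * gaussian s (t - c)))).
  by rewrite le_eqVlt; apply/orP; left; apply/eqP; field.
apply: ler_wpM2l; first by rewrite mulr_ge0// sqr_ge0.
rewrite mulrA; apply: ler_wpM2r; first exact: gaussian_ge0.
exact: dotv_cauchy_schwarz.
Qed.

End stft_lower_bound.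

(** * Norms: lower bounds from cubes, and the norms of Gaussians *)

Section norms.
Local Open Scope ereal_scope.

(* Unlike [ge0_le_integral], this applies to the STFT without proving it
   measurable in (x, w). *)
Lemma ge0_le_integral_nonmeasurable d (T : measurableType d) (R : realType)
    (mu : {measure set T -> \bar R}) (f g : T -> \bar R) :
  (forall x, 0 <= f x) -> (forall x, f x <= g x) ->
  \int[mu]_x f x <= \int[mu]_x g x.
Proof.
move=> f0 fg; have g0 x : 0 <= g x by exact: le_trans (fg x).
(* Both integrals are suprema over simple functions, and every simple function below [f] is below
   [g]. *)
rewrite !ge0_integralTE//; apply: ub_ereal_sup => _ [h hf <-].
by apply: ereal_sup_ubound; exists h => // x; exact: le_trans (fg x).
Qed.

(** The left-hand side is the p-norm of [c] times the indicator of [B], which |h| dominates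
    pointwise. *)
Lemma cLnorm_ge_cst d (T : measurableType d) (R : realType)
    (mu : {measure set T -> \bar R}) (p c m : R) (B : set T) (h : T -> R[i]) :
  (0 < p)%R -> (0 <= c)%R -> measurable B -> mu B = m%:E ->
  (forall x, B x -> (c <= Normc.normc (h x))%R) ->
  (c * m `^ p^-1)%:E <= cLnorm mu p%:E h.
Proof.
move=> p0 c0 mB muB ch; have m0 : (0 <= m)%R by rewrite -lee_fin -muB measure_ge0.
have -> : (c * m `^ p^-1)%R = ((c `^ p * m) `^ p^-1)%R.
  by rewrite powRM ?powR_ge0// -powRrM mulfV ?gt_eqF// powRr1.
rewrite /cLnorm unlock -poweR_EFin; apply: gt0_ler_poweR.
- by rewrite invr_ge0 ltW.
- by rewrite in_itv/= leey lee_fin mulr_ge0// powR_ge0.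
- by rewrite in_itv/= leey andbT integral_ge0.
rewrite EFinM -muB -[B]setIT -integral_indic// -ge0_integralZl//; last 2 first.
- exact/measurable_EFinP/measurable_indic.
- by rewrite lee_fin powR_ge0.
apply: ge0_le_integral_nonmeasurable => x.
  by rewrite -EFinM lee_fin mulr_ge0 ?powR_ge0.
rewrite indicE; have [/set_mem Bx|_] := boolP (x \in B); last first.
  by rewrite mule0 poweR_ge0.
rewrite mule1 abse_EFin poweR_EFin lee_fin ge0_ler_powR ?nnegrE//; first exact: ltW.
by apply: le_trans (ler_norm _); exact: ch.
Qed.

(** The q-th power of G_a is G_(qa). *)
Lemma cLnorm_gaussian (R : realType) d (q a : R) : (0 < q)%R -> (0 < a)%R ->
  cLnorm (lebesgue_rV R d) q%:E (fun t => (gaussian a t)%:C%C) =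
  ((Num.sqrt (pi / (q * a)) ^+ d) `^ q^-1)%:E.
Proof.
move=> q0 a0; rewrite /cLnorm unlock -poweR_EFin; congr (_ `^ _).
rewrite -(@integral_gaussian _ _ _ 0) ?mulr_gt0//.
apply: eq_integral => t _.
rewrite subr0 /= expr0n/= addr0 sqrtr_sqr normr_id ger0_norm ?gaussian_ge0//.
rewrite /gaussian -expRM; congr (expR _)%:E; ring.
Qed.

Lemma cLnormy_gaussian_le1 (R : realType) d (a : R) : (0 < a)%R ->
  cLnorm (lebesgue_rV R d) +oo (fun t => (gaussian a t)%:C%C) <= 1.
Proof.
move=> a0; rewrite /cLnorm unlock; case: ifPn => // mu0.
apply/ess_supP; apply/nearW => t /=.
rewrite expr0n/= addr0 sqrtr_sqr normr_id ger0_norm ?gaussian_ge0// lee_fin.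
by rewrite -expR0 ler_expR oppr_le0 mulr_ge0 ?dotv_ge0// ltW.
Qed.

(** Serves for the Gaussian that stays fixed as s -> oo: its exponent may be infinite while that of
    the narrow one is finite. *)
Lemma cLnorm_gaussian_fin (R : realType) d (q : \bar R) (a : R) : 1 <= q -> (0 < a)%R ->
  exists2 M : R, (0 < M)%R &
    cLnorm (lebesgue_rV R d) q (fun t => (gaussian a t)%:C%C) <= M%:E.
Proof.
move=> q1 a0; case: q q1 => [q q1|_|//].
  have q0 : (0 < q)%R by rewrite (lt_le_trans ltr01)// -lee_fin.
  exists ((Num.sqrt (pi / (q * a)) ^+ d) `^ q^-1)%R; last by rewrite cLnorm_gaussian.
  by rewrite powR_gt0// exprn_gt0// sqrtr_gt0 divr_gt0 ?pi_gt0// mulr_gt0.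
by exists 1%R => //; exact: cLnormy_gaussian_le1.
Qed.

Definition cube (R : realType) d (k : R) : set 'rV[R]_d :=
  [set v | forall i, `[0%R, k]%classic (v ord0 i)].

Lemma lebesgue_rV_cube (R : realType) d (k : R) : (0 <= k)%R ->
  lebesgue_rV R d (cube k) = (k ^+ d)%:E.
Proof.
move=> k0; rewrite /cube (@lebesgue_rV_box _ _ (fun=> `[0%R, k]%classic))//.
rewrite lebesgue_measure_itv/= lte_fin.
have -> : (if (0 < k)%R then k%:E - 0%:E else 0) = k%:E.
  case: ltP => [_|k0']; first by rewrite sube0.
  by congr EFin; apply/eqP; rewrite eq_le k0.
by rewrite prodEFin prodr_const card_ord.
Qed.

Lemma measurable_cube (R : realType) d (k : R) : measurable (cube k : set 'rV[R]_d).
Proof.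
rewrite (_ : cube k = \bigcap_(i in [set: 'I_d]) (@rV_coord R d i @^-1` `[0%R, k])).
  apply: fin_bigcap_measurable => [|i _]; first exact: finite_finset.
  by rewrite -[X in measurable X]setTI; exact: measurable_rV_coord.
by apply/seteqP; split => v /= Av i => [_|]; exact: Av.
Qed.

End norms.

(** * From the lower bound to an inequality between exponents *)

Section exponents.
Context (R : realType).

Lemma dotv_cube_le d (v : 'rV[R]_d) (k : R) :
  cube k v -> dotv v v <= d%:R * k ^+ 2.
Proof.
move=> vk; rewrite (_ : d%:R * k ^+ 2 = \sum_(i < d) k ^+ 2); last first.
  by rewrite sumr_const card_ord mulr_natl.
apply: ler_sum => i _; have /= := vk i; rewrite in_itv/= => /andP[v0 vk'].
by rewrite expr2 ler_pM.
Qed.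

(** On these cubes both losses in [stft_gaussian_ge] are controlled uniformly in [a] and [b]. The
    condition [a * b <= a + b], true when one parameter is 1, bounds the exponential below by
    exp(-d); the size of the [w]-cube keeps the subtracted term below half of the main one. *)
Lemma stft_gaussian_cube d : exists c k : R, [/\ 0 < c, 0 < k &
  forall (a b : R) (x w : 'rV[R]_d), 0 < a -> 0 < b -> a * b <= a + b ->
  cube 1 x -> cube (k * Num.sqrt (a + b)) w ->
  c * (Num.sqrt (a + b))^-1 ^+ d <=
  Normc.normc (stft (fun t => (gaussian b t)%:C%C) (fun t => (gaussian a t)%:C%C) (x, w))].
Proof.
(* With |w|^2 <= d k^2 (a + b), the subtracted term is at most N k^2 times the main one. *)
pose N : R := 4 * pi ^+ 2 * d%:R * Num.sqrt 2 ^+ d.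
have pi4 : 0 <= 4 * pi ^+ 2 :> R by apply: mulr_ge0 => //; exact: sqr_ge0.
have sqrt2d : 0 <= Num.sqrt 2 ^+ d :> R by exact: exprn_ge0.
have N0 : 0 <= N by apply: mulr_ge0 => //; exact: mulr_ge0.
(* Chosen so that N k^2 <= 1/2; adding 1 keeps the denominator positive even if N = 0. *)
pose k := (2 * (N + 1))^-1.
have k0 : 0 < k by rewrite invr_gt0 mulr_gt0// ltr_wpDl.
have kN : N * k ^+ 2 <= 2^-1.
  have k1 : 2 * (N + 1) * k = 1 by rewrite mulfV// gt_eqF// mulr_gt0// ltr_wpDl.
  nra.
have spi0 : 0 < Num.sqrt pi :> R by rewrite sqrtr_gt0 pi_gt0.
exists (expR (- d%:R) * (Num.sqrt pi ^+ d / 2)), k; split => //.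
  by rewrite mulr_gt0 ?expR_gt0// divr_gt0// exprn_gt0.
move=> a b x w a0 b0 ab hx hw.
apply: le_trans (stft_gaussian_ge x w a0 b0).
have s0 : 0 < a + b by rewrite addr_gt0.
set s := a + b in ab hw s0 *.
have ss0 : 0 < Num.sqrt s by rewrite sqrtr_gt0.
rewrite -mulrA; apply: ler_pM.
- exact: expR_ge0.
- by rewrite mulr_ge0 ?exprn_ge0 ?invr_ge0 ?divr_ge0 ?exprn_ge0// ltW.
- rewrite ler_expR lerN2 -[leRHS]mul1r; apply: ler_pM.
  + by rewrite divr_ge0 ?mulr_ge0// ltW.
  + exact: dotv_ge0.
  + by rewrite ler_pdivrMr// mul1r.
  + by have := dotv_cube_le hx; rewrite expr1n mulr1.
have -> : Num.sqrt (2 * pi / s) = Num.sqrt 2 * (Num.sqrt pi / Num.sqrt s).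
  by rewrite -mulrA sqrtrM// sqrtrM ?pi_ge0// sqrtrV// ltW.
have -> : Num.sqrt (pi / s) = Num.sqrt pi / Num.sqrt s.
  by rewrite sqrtrM ?pi_ge0// sqrtrV// ltW.
set P := Num.sqrt pi / Num.sqrt s.
have P0 : 0 <= P ^+ d by rewrite exprn_ge0// divr_ge0// ltW.
have -> : Num.sqrt pi ^+ d / 2 * (Num.sqrt s)^-1 ^+ d = P ^+ d / 2.
  by rewrite /P exprMn mulrAC.
have hw2 : dotv w w <= d%:R * k ^+ 2 * s.
  by have := dotv_cube_le hw; rewrite exprMn sqr_sqrtr ?mulrA// ltW.
have -> : P ^+ d - 4 * pi ^+ 2 * dotv w w / s * (Num.sqrt 2 * P) ^+ d =
    P ^+ d * (1 - 4 * pi ^+ 2 * Num.sqrt 2 ^+ d * (dotv w w / s)).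
  by rewrite (exprMn _ (Num.sqrt 2) P); ring.
apply: ler_wpM2l => //.
have : 4 * pi ^+ 2 * Num.sqrt 2 ^+ d * (dotv w w / s) <= N * k ^+ 2.
  rewrite (_ : N * k ^+ 2 = 4 * pi ^+ 2 * Num.sqrt 2 ^+ d * (d%:R * k ^+ 2)); last first.
    by rewrite /N; ring.
  apply: ler_wpM2l; first exact: mulr_ge0.
  by rewrite ler_pdivrMr.
lra.
Qed.

(** The pointwise bound is integrated over the product of the two cubes; the unit cube in [x]
    contributes measure 1. *)
Lemma stft_gaussian_Lnorm_ge d (p : R) : 0 < p -> exists c k : R, [/\ 0 < c, 0 < k &
  forall a b : R, 0 < a -> 0 < b -> a * b <= a + b ->
  ((c * (Num.sqrt (a + b))^-1 ^+ d * ((k * Num.sqrt (a + b)) ^+ d) `^ p^-1)%:E <=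
  cLnorm (lebesgue_rV R d \x lebesgue_rV R d) p%:E
    (stft (fun t => (gaussian b t)%:C%C) (fun t => (gaussian a t)%:C%C)))%E].
Proof.
move=> p0; have [c [k [c0 k0 H]]] := stft_gaussian_cube d.
exists c, k; split => // a b a0 b0 ab.
have ks0 : 0 <= k * Num.sqrt (a + b) by rewrite mulr_ge0// ltW.
apply: (@cLnorm_ge_cst _ _ _ _ _ _ _ (cube 1 `*` cube (k * Num.sqrt (a + b)))) => //.
- by rewrite mulr_ge0 ?exprn_ge0 ?invr_ge0// ltW.
- by apply: measurableX; exact: measurable_cube.
- rewrite /= product_measure1E; [|exact: measurable_cube..].
  apply: etrans (congr2 mule (lebesgue_rV_cube d ler01) (lebesgue_rV_cube d ks0)) _.
  by rewrite expr1n mul1e.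
- by move=> [x w] [/= hx hw]; exact: H.
Qed.

Lemma slope_le0 (m B : R) : (forall t, 1 <= t -> m * t <= B) -> m <= 0.
Proof.
move=> H; rewrite leNgt; apply/negP => m0.
(* At this [t] the product m t equals |B| + m, which exceeds B. *)
have B1 : 1 <= (`|B| + m) / m by rewrite ler_pdivlMr// mul1r lerDr.
have := H _ B1; rewrite mulrC divfK ?gt_eqF//.
have := ler_norm B; lra.
Qed.

(** With s = exp(2t), the logarithm of the hypothesis is linear in [t]: the slope d (1/q - 1 + 1/p)
    times [t] stays bounded for t >= 1, so the slope is not positive, and d > 0 can be cancelled. *)
Lemma exponent_le d (p q c k K : R) :
  (0 < d)%N -> 0 < p -> 0 < q -> 0 < c -> 0 < k -> 0 < K ->
  (forall s, 2 <= s ->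
    c * (Num.sqrt s)^-1 ^+ d * ((k * Num.sqrt s) ^+ d) `^ p^-1 <=
    K * (Num.sqrt (pi / (q * (s - 1))) ^+ d) `^ q^-1) ->
  q^-1 <= 1 - p^-1.
Proof.
(* For s >= 2 one has s - 1 >= s/2, so the square root on the right is at most A / sqrt s. *)
move=> d0 p0 q0 c0 k0 K0 H; pose A := Num.sqrt (2 * pi / q).
have A0 : 0 < A by rewrite sqrtr_gt0 divr_gt0// mulr_gt0// pi_gt0.
have dR0 : 0 < d%:R :> R by rewrite ltr0n.
suff : d%:R * (q^-1 - 1 + p^-1) <= 0 by rewrite pmulr_rle0//; lra.
apply: (@slope_le0 _ (ln K + q^-1 * (d%:R * ln A) - ln c - p^-1 * (d%:R * ln k))) => t t1.
have sE : Num.sqrt (expR t ^+ 2) = expR t by rewrite sqrtr_sqr ger0_norm// expR_ge0.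
have s2 : 2 <= expR t ^+ 2.
  have := expR_ge1Dx t; nra.
have := H _ s2; rewrite sE => {}H.
have : c * (expR t)^-1 ^+ d * ((k * expR t) ^+ d) `^ p^-1 <=
    K * ((A * (expR t)^-1) ^+ d) `^ q^-1.
  apply: (le_trans H); rewrite ler_pM2l//; apply: ge0_ler_powR.
  - by rewrite invr_ge0 ltW.
  - by rewrite nnegrE exprn_ge0.
  - by rewrite nnegrE exprn_ge0// divr_ge0 ?expR_ge0// ltW.
  apply: lerXn2r; rewrite ?nnegrE// ?divr_ge0 ?expR_ge0 ?(ltW A0)//.
  have -> : A / expR t = Num.sqrt (2 * pi / q / expR t ^+ 2).
    by rewrite sqrtrM ?sqrtrV ?sqr_ge0 ?sE// divr_ge0 ?mulr_ge0 ?pi_ge0// ltW.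
  rewrite ler_wsqrtr//; set s := expR t ^+ 2 in s2 *.
  have -> : 2 * pi / q / s = pi / (q * (s / 2)) by field; rewrite !gt_eqF//; lra.
  rewrite ler_wpM2l ?pi_ge0// lef_pV2 ?posrE ?ler_pM2l ?mulr_gt0 ?subr_gt0 ?expR_gt0//; lra.
rewrite -(lnK (x := c)) ?posrE// -(lnK (x := k)) ?posrE//.
rewrite -(lnK (x := K)) ?posrE// -(lnK (x := A)) ?posrE//.
rewrite -!expRN -!expRD -!expRM_natl -!expRM -!expRD ler_expR.
by rewrite !expRK; lra.
Qed.

End exponents.

(** * Conjugate exponents and the conclusion *)

Local Open Scope ereal_scope.

Lemma hoelder_conjugate_le (R : realType) (p : R) (q : \bar R) : (1 <= p)%R -> 1 <= q ->
  (forall q0 : R, q = q0%:E -> (q0^-1 <= 1 - p^-1)%R) ->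
  hoelder_conjugate p%:E <= q.
Proof.
move=> p1 q1 H; case: q q1 H => [q q1 H|_ _|//]; last exact: leey.
have {}H := H _ erefl; have q0 : (0 < q)%R by rewrite (lt_le_trans ltr01).
have p0 : (0 < p)%R by rewrite (lt_le_trans ltr01).
(* Since 1/q > 0, the hypothesis excludes p = 1; hence p' is the finite number p/(p - 1) = 1/(1 -
   1/p). *)
have pq : (0 < 1 - p^-1)%R by rewrite (lt_le_trans _ H)// invr_gt0.
have p1' : (0 < p - 1)%R.
  by rewrite (_ : p - 1 = p * (1 - p^-1))%R ?mulr_gt0//; field; rewrite gt_eqF.
rewrite /hoelder_conjugate/= eqe gt_eqF// inver gt_eqF// -EFinM lee_fin.
rewrite (_ : p / (p - 1) = (1 - p^-1)^-1)%R; last by field; rewrite !gt_eqF.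
by rewrite -[leRHS]invrK lef_pV2// posrE invr_gt0.
Qed.

(** As 1/r + 1/r' = 1, adding the two inequalities gives 1 <= 2 - 2/p. *)
Lemma exponent_ge2 (R : realType) (p : R) (r : \bar R) : (1 <= p)%R -> 1 <= r ->
  (forall q0 : R, r = q0%:E -> (q0^-1 <= 1 - p^-1)%R) ->
  (forall q0 : R, hoelder_conjugate r = q0%:E -> (q0^-1 <= 1 - p^-1)%R) ->
  (2 <= p)%R.
Proof.
move=> p1 r1 Hr Hr'; have p0 : (0 < p)%R by rewrite (lt_le_trans ltr01).
have pV0 : (0 < p^-1)%R by rewrite invr_gt0.
suff : (p^-1 <= 2^-1)%R by rewrite lef_pV2 ?posrE.
(* If [r] is +oo or 1, one of the two exponents is 1 and its inequality reads 1 <= 1 - 1/p, absurd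
   for finite [p]. *)
case: r r1 Hr Hr' => [r r1 Hr Hr'|_ _ Hr'|//]; last first.
  have := Hr' 1%R erefl; rewrite invr1; lra.
have r0 : (0 < r)%R by rewrite (lt_le_trans ltr01).
have {}Hr := Hr _ erefl.
have [req1|rne1] := eqVneq r 1%R; first by move: Hr; rewrite req1 invr1; lra.
have rr : hoelder_conjugate r%:E = (r / (r - 1))%:E.
  by rewrite /hoelder_conjugate/= eqe gt_eqF// inver subr_eq0 (negbTE rne1).
have := Hr' _ rr; rewrite (_ : (r / (r - 1))^-1 = 1 - r^-1)%R; first lra.
by field; rewrite gt_eqF//= subr_eq0.
Qed.

Theorem proposition3p3 (R : realType) (d : nat) (p r : \bar R)
    (hd : (1 <= d)%N) (hp : 1 <= p) (hr : 1 <= r) :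
  (exists2 C : R, (0 < C)%R &
    forall f g : 'rV[R]_d -> R[i], schwartz f -> schwartz g ->
      cLnorm (lebesgue_rV R d \x lebesgue_rV R d) p (stft g f) <=
      C%:E * cLnorm (lebesgue_rV R d) (hoelder_conjugate r) g
           * cLnorm (lebesgue_rV R d) r f) ->
  hoelder_conjugate p <= Order.min r (hoelder_conjugate r) /\ 2%:E <= p.
Proof.
move=> [C C0 H]; have hr' := hoelder_conj_ge1 hr.
(* For p = +oo the conjugate is 1, which is at most both [r] and [r']. *)
case: p hp H => [p hp H|_ _|//]; last first.
  by rewrite hoelder_conjugatey le_min hr hr' leey.
have p0 : (0 < p)%R by rewrite (lt_le_trans ltr01).
have [c [k [c0 k0 Vge]]] := stft_gaussian_Lnorm_ge d p0.
have sch (a : R) : (0 < a)%R -> schwartz (fun t : 'rV[R]_d => (gaussian a t)%:C%C).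
  exact: schwartz_gaussian.
(* Here [f] is the narrow Gaussian G_(s-1) and the window is G_1, whose r'-norm, at most [M], goes
   into the constant [C * M]. *)
have Hr q : r = q%:E -> (q^-1 <= 1 - p^-1)%R.
  move=> rq; have q0 : (0 < q)%R by rewrite (lt_le_trans ltr01)// -lee_fin -rq.
  have := cLnorm_gaussian_fin d hr' (@ltr01 R); rewrite rq => -[M M0 HM].
  apply: (@exponent_le _ d p q c k (C * M)) => //; first exact: mulr_gt0.
  move=> s s2; have s1 : (0 < s - 1)%R by lra.
  have ab : ((s - 1) * 1 <= s - 1 + 1)%R by lra.
  have := Vge _ _ s1 ltr01 ab; rewrite subrK -lee_fin => /le_trans; apply.
  apply: le_trans (H _ _ (sch _ s1) (sch _ ltr01)) _.
  rewrite rq cLnorm_gaussian// EFinM; apply: lee_wpmul2r.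
    by rewrite lee_fin powR_ge0.
  by rewrite EFinM; apply: lee_wpmul2l => //; rewrite lee_fin ltW.
(* The roles are exchanged: the window is narrow, and [M] bounds the r-norm of f = G_1. *)
have Hr' q : hoelder_conjugate r = q%:E -> (q^-1 <= 1 - p^-1)%R.
  move=> rq; have q0 : (0 < q)%R by rewrite (lt_le_trans ltr01)// -lee_fin -rq.
  have [M M0 HM] := cLnorm_gaussian_fin d hr (@ltr01 R).
  apply: (@exponent_le _ d p q c k (C * M)) => //; first exact: mulr_gt0.
  move=> s s2; have s1 : (0 < s - 1)%R by lra.
  have ab : (1 * (s - 1) <= 1 + (s - 1))%R by lra.
  have := Vge _ _ ltr01 s1 ab; rewrite addrC subrK -lee_fin => /le_trans; apply.
  apply: le_trans (H _ _ (sch _ ltr01) (sch _ s1)) _.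
  rewrite rq cLnorm_gaussian// muleAC EFinM; apply: lee_wpmul2r.
    by rewrite lee_fin powR_ge0.
  by rewrite EFinM; apply: lee_wpmul2l => //; rewrite lee_fin ltW.
split; last by rewrite lee_fin; exact: (@exponent_ge2 _ _ r).
by rewrite le_min !hoelder_conjugate_le.
Qed.
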